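(* Consider the pricing model described in the context with $C\ge1$ servers, and any $\Lambda>0$, $\mu>0$ and regular $F$. Let $\pi^*$ be an optimal dynamic policy and $\tilde\lambda=\sum_{i\ge0}\lambda_i^*\mathbb{P}_i(\pi^* )$ its average arrival rate. Then the static policy $\pi^{\tilde\lambda,C-1}$ satisfies \[ \mathcal{Z}(\pi^{\tilde\lambda,C-1})\ \ge\ \mathcal{Z}(\pi^* )\left(1-\frac{\frac{1}{C!}C^C}{\sum_{n=0}^{C}\frac{1}{n!}C^n}\right). \]
   Context: Model: a service system with $C\ge 1$ identical parallel servers and one first-come-first-served queue of unlimited size. Potential customers arrive according to a Poisson process of rate $\Lambda>0$; each has a valuation drawn i.i.d. from a regular (in Myerson's sense) distribution $F$. A customer offered price $p$ joins iff their valuation is at least $p$, so the effective arrival rate is $\lambda(p)=\Lambda(1-F(p))$; this map is assumed to be a bijection between prices and rates, with inverse $p(\lambda)$, and $\lambda\mapsto\lambda p(\lambda)$ is concave. Service times are i.i.d. exponential with rate $\mu>0$, independent of valuations. The provider incurs a congestion cost $c>0$ per customer in the system per unit time. A policy $\pi$ is a sequence $(\lambda_0,\lambda_1,\dots)$ with $\lambda_i\in[0,\Lambda]$: with $i$ customers present the price $p(\lambda_i)$ is posted. The number in system is a birth–death process with birth rate $\lambda_i$ and death rate $\mu\min(i,C)$ in state $i$; when stable its stationary probabilities are $\mathbb{P}_i(\pi)=\prod_{k=0}^{i-1}\frac{\lambda_k}{\mu\min(k+1,C)}\big/\big(1+\sum_{n\ge0}\prod_{k=0}^{n}\frac{\lambda_k}{\mu\min(k+1,C)}\big)$.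 Revenue rate $\mathcal{R}(\pi)=\sum_{i}\lambda_i p(\lambda_i)\mathbb{P}_i(\pi)$; congestion cost $\mathcal{C}(\pi)=c\sum_i i\,\mathbb{P}_i(\pi)$ ($+\infty$ if unstable); objective $\mathcal{Z}(\pi)=\mathcal{R}(\pi)-\mathcal{C}(\pi)$. An optimal dynamic policy $\pi^*=(\lambda_0^*,\lambda_1^*,\dots)$ maximizes $\mathcal{Z}$ over all such policies. For a rate $\lambda$ and integer $\gamma\ge0$, the static (cutoff) policy $\pi^{\lambda,\gamma}$ uses arrival rate $\lambda$ in states $0,1,\dots,\gamma$ and arrival rate $0$ in all states $\ge\gamma+1$. *)

(* Defs.v *)
From HB Require Import structures.
From mathcomp Require Import all_boot all_order all_algebra.
From mathcomp Require Import all_classical all_reals all_analysis.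

Set Implicit Arguments.
Unset Strict Implicit.
Unset Printing Implicit Defensive.

Import Order.TTheory GRing.Theory Num.Theory.
Import numFieldNormedType.Exports.

Local Open Scope classical_set_scope.
Local Open Scope ring_scope.

Section Valuations.
Context {R : realType}.
Implicit Types (F f p : R -> R) (Lambda v : R).

Definition has_density F f :=
  [/\ measurable_fun setT f, forall v, 0 <= f v &
      forall v,
        (F v)%:E = (\int[lebesgue_measure]_(x in `]-oo, v]) (f x)%:E)%E].

Definition virtual_value F f v : R := v - (1 - F v) / f v.

(* Myerson regularity: F has a density that is positive on the support and
   whose virtual value is nondecreasing there.  For a continuous distribution
   function, [set v | 0 < F v < 1] is the support up to its end points. *)
Definition regular F := exists f,
  [/\ has_density F f,
      forall v, 0 < F v < 1 -> 0 < f v &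
      forall u v, 0 < F u -> u <= v -> F v < 1 ->
        virtual_value F f u <= virtual_value F f v].

Definition arrival_rate Lambda F (price : R) : R := Lambda * (1 - F price).

(* The price of rate 0 may be infinite (unbounded valuations), and it plays no
   role since 0 * p 0 = 0; the correspondence between prices and rates is
   therefore only required for positive rates, and p 0 is arbitrary. *)
Definition inverse_demand Lambda F (prices : set R) p :=
  [/\ set_bij prices `]0, Lambda] (arrival_rate Lambda F),
      set_fun `]0, Lambda] prices p &
      {in `]0, Lambda], cancel p (arrival_rate Lambda F)}].

Definition concave_revenue Lambda p :=
  convex_function `[0, Lambda] (fun lambda : R^o => - (lambda * p lambda) : R^o).

End Valuations.

Section Queue.
Context {R : realType}.
Implicit Types (C : nat) (Lambda mu c : R) (p : R -> R) (pi : nat -> R).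

(* A policy is given by its arrival rates: pi i is the rate posted when i
   customers are present. *)
Definition policy Lambda pi := forall i, 0 <= pi i <= Lambda.

Definition static_policy (lambda : R) (gamma : nat) (i : nat) : R :=
  if (i <= gamma)%N then lambda else 0.

Definition weight C mu pi (n : nat) : R :=
  \prod_(k < n) (pi k / (mu * (minn k.+1 C)%:R)).

Definition stable C mu pi := cvgn (series (fun n => weight C mu pi n.+1)).

(* Meaningful for stable policies only, like avg_rate and revenue below. *)
Definition stationary_prob C mu pi (i : nat) : R :=
  weight C mu pi i / (1 + limn (series (fun n => weight C mu pi n.+1))).

Definition avg_rate C mu pi : R :=
  limn (series (fun i => pi i * stationary_prob C mu pi i)).

Definition revenue C mu p pi : R :=
  limn (series (fun i => pi i * p (pi i) * stationary_prob C mu pi i)).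

Definition congestion_cost C mu c pi : \bar R :=
  if `[< stable C mu pi >]
  then (c%:E * \sum_(0 <= i <oo) (i%:R * stationary_prob C mu pi i)%:E)%E
  else +oo%E.

Definition objective C mu c p pi : \bar R :=
  ((revenue C mu p pi)%:E - congestion_cost C mu c pi)%E.

Definition optimal_policy C Lambda mu c p pi :=
  policy Lambda pi /\
  forall pi', policy Lambda pi' ->
    (objective C mu c p pi' <= objective C mu c p pi)%E.

End Queue.

(* Main.v *)
(* Let a be the average rate of the optimal policy and r(x) = x p(x). Flow
   balance pi_i P_i = mu min(i + 1, C) P_(i+1) gives a = mu E[min(N, C)] for the
   number N of customers, so a <= mu C and E[N] >= a / mu. By Jensen the revenue
   is at most r(a), hence the optimum is at most r(a) - c a / mu. The static
   policy is an Erlang loss system with offered load a / mu: its objective is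
   exactly (r(a) - c a / mu) (1 - B) for the Erlang loss probability B, which
   increases with the load and is therefore at most its value at load C. Since
   the zero policy has objective 0, r(a) - c a / mu >= 0. *)

Require Import Defs.
From HB Require Import structures.
From mathcomp Require Import all_boot all_order all_algebra.
From mathcomp Require Import all_classical all_reals all_analysis.
From mathcomp Require Import ring lra.
Import Order.TTheory GRing.Theory Num.Theory.
Import numFieldNormedType.Exports.
Local Open Scope classical_set_scope.
Local Open Scope ring_scope.

Set Implicit Arguments.
Unset Strict Implicit.
Unset Printing Implicit Defensive.

(** * Convex functions on a closed interval: chords, supporting lines, boundedness *)

Section ConvexFunctions.
Context {R : realType}.
Implicit Types (a b m s x y : R) (f : R -> R).

(** The point [m] is the convex combination of [x] and [y] with weight [(y - m) / (y - x)] on [x].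
    Multiplying by [y - x] keeps the inequality free of division. *)
Lemma convex_function_chord a b f x m y :
  convex_function `[a, b] (f : R^o -> R^o) ->
  a <= x -> x <= m -> m <= y -> y <= b -> x < y ->
  (y - x) * f m <= (y - m) * f x + (m - x) * f y.
Proof.
move=> fconv ax xm my yb xy.
have yx0 : 0 < y - x by rewrite subr_gt0.
have t0 : 0 <= (y - m) / (y - x) by rewrite divr_ge0 ?subr_ge0// ltW.
have t1 : (y - m) / (y - x) <= 1 by rewrite ler_pdivrMr// mul1r lerD2l lerN2.
have xab : x \in `[a, b]%classic by apply/mem_set; rewrite /= in_itv/= ax (le_trans (ltW xy)).
have yab : y \in `[a, b]%classic by apply/mem_set; rewrite /= in_itv/= yb (le_trans ax (ltW xy)).
have := fconv (Itv01 t0 t1) x y xab yab.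
rewrite (_ : conv _ _ _ = (m : convex_lmodType R^o)); last first.
  apply: etrans (convRE x y (Itv01 t0 t1)) _.
  by rewrite /= /unstable.onem; field; rewrite gt_eqF.
rewrite convRE /= /unstable.onem.
move=> fm; rewrite -(ler_pM2l yx0) in fm; apply: le_trans fm _; rewrite le_eqVlt; apply/orP; left.
by apply/eqP; field; rewrite gt_eqF.
Qed.

(** The slope is the supremum of the slopes of chords ending at [m] from the left. Each of them is
    at most the slope of any chord leaving [m] to the right. The chord from [a] makes the set
    nonempty, the chord to [b] bounds it. *)
Lemma convex_support_line a b f m :
  convex_function `[a, b] (f : R^o -> R^o) -> a < m < b ->
  exists s, forall x, a <= x <= b -> f m + s * (x - m) <= f x.
Proof.
move=> fconv /andP[am mb].
pose slopes := [set (f m - f x) / (m - x) | x in [set x | a <= x < m]].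
have ub y : m < y -> y <= b -> ubound slopes ((f y - f m) / (y - m)).
  move=> my yb _ [x /andP[ax xm] <-].
  rewrite ler_pdivrMr ?subr_gt0// mulrAC ler_pdivlMr ?subr_gt0//.
  have := convex_function_chord fconv ax (ltW xm) (ltW my) yb (lt_trans xm my).
  nra.
have slopes0 : slopes !=set0.
  by exists ((f m - f a) / (m - a)); exists a => //=; rewrite lexx.
exists (sup slopes) => x /andP[ax xb].
have [xm|mx|->] := ltgtP x m; last by rewrite subrr mulr0 addr0.
- have : (f m - f x) / (m - x) <= sup slopes.
    apply: ub_le_sup; last by exists x => //=; rewrite ax.
    by exists ((f b - f m) / (b - m)); exact: ub.
  by rewrite ler_pdivrMr ?subr_gt0//; lra.
- have : sup slopes <= (f x - f m) / (x - m) by apply: ge_sup => //; exact: ub.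
  by rewrite ler_pdivlMr ?subr_gt0//; lra.
Qed.

(** From above, the chord between [a] and [b] bounds [f]; from below, a supporting line at the
    midpoint does. If [b <= a], the interval has at most one point. *)
Lemma convex_function_bounded a b f :
  convex_function `[a, b] (f : R^o -> R^o) ->
  exists M, forall x, a <= x <= b -> `|f x| <= M.
Proof.
move=> fconv; have [ab|ba] := ltP a b; last first.
  exists `|f a| => x /andP[ax xb].
  by have -> // : x = a by apply/eqP; rewrite eq_le ax (le_trans xb).
have [|s hs] := @convex_support_line a b f ((a + b) / 2) fconv.
  by apply/andP; split; lra.
set m := (a + b) / 2 in hs.
exists (`|f a| + `|f b| + `|f m| + `|s| * (b - a)) => x /andP[ax xb].
have ba0 : 0 < b - a by rewrite subr_gt0.
have lo : f m - `|s| * (b - a) <= f x.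
  apply: le_trans (hs x _); last by rewrite ax.
  rewrite lerD2l lerNl -mulrN (le_trans (ler_norm _))// normrM normrN.
  by rewrite ler_wpM2l// ler_norml /m; apply/andP; split; lra.
have hi : f x <= `|f a| + `|f b|.
  rewrite -(ler_pM2l ba0).
  apply: le_trans (convex_function_chord fconv (lexx a) ax xb (lexx b) ab) _.
  have := ler_norm (f a); have := ler_norm (f b).
  have := normr_ge0 (f a); have := normr_ge0 (f b); nra.
have := normr_ge0 (f a); have := normr_ge0 (f b).
have := ler_norm (f m); have := ler_norm (- f m); rewrite normrN.
have : 0 <= `|s| * (b - a) by rewrite mulr_ge0// ltW.
by rewrite ler_norml; move=> *; apply/andP; split; lra.
Qed.

End ConvexFunctions.

(** * Series weighted by a probability sequence, and Jensen's inequality *)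

Section WeightedSeries.
Context {R : realType}.
Implicit Types (a b : R) (f : R -> R) (u v x P : nat -> R).

Lemma cvg_lin_comb_series a b u v l l' :
  series u @ \oo --> (l : R) -> series v @ \oo --> (l' : R) ->
  series (fun i => a * u i + b * v i) @ \oo --> a * l + b * l'.
Proof.
move=> ul vl.
rewrite (_ : series _ = (fun n => a * series u n + b * series v n)).
  by apply: cvgD; apply: cvgMl_tmp.
by apply/funext => n; rewrite /series/= !mulr_sumr -big_split.
Qed.

Lemma is_cvg_weighted_series u P (M : R) :
  (forall i, `|u i| <= M) -> (forall i, 0 <= P i) -> cvgn (series P) ->
  cvgn (series (fun i => u i * P i)).
Proof.
move=> uM P0 cP; apply: normed_cvg.
apply: (@series_le_cvg _ _ (M *: P)).
- by move=> i; rewrite normr_ge0.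
- by move=> i; rewrite mulr_ge0// (le_trans (normr_ge0 (u 0%N))).
- by move=> i /=; rewrite normrM (ger0_norm (P0 i)) ler_wpM2r.
- exact: is_cvg_seriesZ.
Qed.

Lemma cvg_series_ge0 u l :
  (forall i, 0 <= u i) -> series u @ \oo --> (l : R) -> 0 <= l.
Proof.
move=> u0 ul; apply: (cvgr_to_ge ul).
by apply: nearW => n; exact: sumr_ge0.
Qed.

Lemma nonneg_series0 u :
  (forall i, 0 <= u i) -> series u @ \oo --> (0 : R) -> forall i, u i = 0.
Proof.
move=> u0 ul i.
have nd : nondecreasing_seq (series u) by exact: nondecreasing_series.
have cu : cvgn (series u) by apply/cvg_ex; exists 0.
have := nondecreasing_cvgn_le nd cu i.+1; rewrite (cvg_lim _ ul)// seriesSr.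
have : 0 <= series u i by exact: sumr_ge0.
by have := u0 i; lra.
Qed.

Lemma is_cvg_convex_series a b f P x :
  convex_function `[a, b] (f : R^o -> R^o) ->
  (forall i, a <= x i <= b) -> (forall i, 0 <= P i) -> cvgn (series P) ->
  cvgn (series (fun i => f (x i) * P i)).
Proof.
move=> /convex_function_bounded[M fM] xab P0 cP.
by apply: (@is_cvg_weighted_series _ _ M) => // i; exact: fM.
Qed.

(* If the mean is an end point of [a, b], all the mass sits there; otherwise
   integrate a supporting line at the mean. *)
Lemma jensen_series a b f P x :
  convex_function `[a, b] (f : R^o -> R^o) ->
  (forall i, a <= x i <= b) -> (forall i, 0 <= P i) ->
  series P @ \oo --> (1 : R) ->
  f (limn (series (fun i => x i * P i))) <=
  limn (series (fun i => f (x i) * P i)).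
Proof.
move=> fconv xab P0 P1.
have cP : cvgn (series P) by apply/cvg_ex; exists 1.
have cf : cvgn (series (fun i => f (x i) * P i)).
  exact: is_cvg_convex_series fconv _ _ _.
have cx : cvgn (series (fun i => x i * P i)).
  apply: (@is_cvg_weighted_series _ _ (`|a| + `|b|)) => // i.
  have /andP[] := xab i; have := ler_norm (- a); have := ler_norm b.
  have := normr_ge0 a; have := normr_ge0 b.
  by rewrite normrN ler_norml => *; apply/andP; split; lra.
set m := limn (series (fun i => x i * P i)).
(* As [P] has total mass 1, the average of an affine function of [x] is its value at [m]. *)
have mean s t : series (fun i => s * (x i * P i) + t * P i) @ \oo -->
    s * m + t.
  by rewrite -[t in X in _ --> X]mulr1; exact: cvg_lin_comb_series.
have mge : a <= m.
  rewrite -subr_ge0 -(mul1r m); apply: cvg_series_ge0 (mean 1 (- a)) => i.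
  by rewrite mul1r -mulrDl mulr_ge0// subr_ge0; case/andP: (xab i).
have mle : m <= b.
  rewrite -subr_ge0 addrC -mulN1r; apply: cvg_series_ge0 (mean (-1) b) => i.
  by rewrite mulN1r addrC -mulrBl mulr_ge0// subr_ge0; case/andP: (xab i).
(* If all [x i] lie on one side of [m], the terms [s * (x i - m) * P i] are nonnegative with sum 0,
   so each vanishes: [x i = m] or [P i = 0]. End points are treated apart because a convex function
   may jump, or have infinite slope, there. *)
have end_point s : (forall i, 0 <= s * (x i - m)) -> s != 0 ->
    forall i, f m * P i = f (x i) * P i.
  move=> sx sN0 i.
  have : s * (x i * P i) + - (s * m) * P i = 0.
    apply: (@nonneg_series0 (fun k => s * (x k * P k) + - (s * m) * P k)).
      move=> k.
      by rewrite mulrA -mulrDl -mulrBr mulr_ge0.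
    by rewrite -[X in _ --> X](subrr (s * m)); exact: mean.
  rewrite mulrA -mulrDl -mulrBr => /eqP; rewrite mulf_eq0 mulf_eq0 (negbTE sN0).
  by rewrite subr_eq0/= => /orP[/eqP->//|/eqP->]; rewrite !mulr0.
have [s hs] : exists s, forall i,
    s * (x i * P i) + (f m - s * m) * P i <= f (x i) * P i.
  have [am|ma|ma] := ltgtP a m; last 1 first.
  - exists 0 => i; rewrite !mul0r add0r subr0.
    rewrite (end_point 1) ?oner_eq0// => k.
    by rewrite mul1r subr_ge0 -ma; case/andP: (xab k).
  - have [mb|bm|mb] := ltgtP m b.
    + have [|s hs] := @convex_support_line _ a b f m fconv; first by rewrite am.
      exists s => i; rewrite mulrA -mulrDl ler_wpM2r//.
      by rewrite (le_trans _ (hs _ (xab i)))//; lra.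
    + by move: bm; rewrite ltNge mle.
    + exists 0 => i; rewrite !mul0r add0r subr0.
      rewrite (end_point (-1)) ?oppr_eq0 ?oner_eq0// => k.
      by rewrite mulN1r oppr_ge0 subr_le0 mb; case/andP: (xab k).
  - by move: ma; rewrite ltNge mge.
have := mean s (f m - s * m); rewrite (addrC (s * m)) subrK => fm.
rewrite -(cvg_lim (@Rhausdorff R) fm); apply: lim_series_le => //.
by apply/cvg_ex; exists (f m).
Qed.

Lemma cvg_series_finite u N :
  (forall n, (N <= n)%N -> u n = 0) ->
  series u @ \oo --> \sum_(0 <= n < N) u n.
Proof.
move=> u0; apply: cvg_near_cst; near=> n.
have Nn : (N <= n)%N by near: n; exact: nbhs_infty_ge.
rewrite /series/= (big_cat_nat (n := N))//= [X in _ + X]big_nat_cond.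
by rewrite [X in _ + X]big1 ?addr0// => i /andP[/andP[Ni _] _]; exact: u0.
Unshelve. all: by end_near. Qed.

Lemma nneseries_finite u N :
  (forall n, (N <= n)%N -> u n = 0) ->
  (\sum_(0 <= n <oo) (u n)%:E = (\sum_(0 <= n < N) u n)%:E)%E.
Proof.
move=> /cvg_series_finite ul; rewrite -(cvg_lim (@Rhausdorff R) ul).
rewrite -EFin_lim; last by apply/cvg_ex; eexists; exact: ul.
by congr (limn _); apply/funext => n; rewrite sumEFin.
Qed.

End WeightedSeries.

(** * Erlang loss formula with offered load [rho] *)

Definition erlang_loss (R : fieldType) C (rho : R) : R :=
  (rho ^+ C / C`!%:R) / \sum_(n < C.+1) rho ^+ n / n`!%:R.

Section ErlangLoss.
Context {R : realFieldType}.
Implicit Types (C : nat) (rho sigma : R).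

Let normalizer C rho : R := \sum_(n < C.+1) rho ^+ n / n`!%:R.

Let normalizer_gt0 C rho : 0 <= rho -> 0 < normalizer C rho.
Proof.
move=> rho0; rewrite /normalizer big_ord_recl/= expr0 fact0 divr1.
by rewrite ltr_pwDl// sumr_ge0// => i _; rewrite divr_ge0// exprn_ge0.
Qed.

(** After cross-multiplication the sums compare term by term: for [n <= C], [rho ^+ C * sigma ^+ n
    <= sigma ^+ C * rho ^+ n], since the common factor [rho ^+ n * sigma ^+ n] leaves
    [rho ^+ (C - n) <= sigma ^+ (C - n)]. *)
Lemma erlang_loss_le C rho sigma : 0 <= rho -> rho <= sigma ->
  erlang_loss C rho <= erlang_loss C sigma.
Proof.
move=> rho0 rs; have sigma0 := le_trans rho0 rs.
rewrite /erlang_loss -/(normalizer C rho) -/(normalizer C sigma).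
rewrite ler_pdivrMr ?normalizer_gt0// mulrAC ler_pdivlMr ?normalizer_gt0//.
rewrite mulrAC [leRHS]mulrAC ler_wpM2r//.
rewrite /normalizer !mulr_sumr; apply: ler_sum => n _; rewrite !mulrA.
rewrite ler_wpM2r//.
move: (nat_of_ord n) (ltn_ord n) => k; rewrite ltnS => kC.
rewrite -(subnK kC) !exprD -!mulrA [sigma ^+ k * _]mulrC.
by apply: ler_wpM2r; rewrite ?mulr_ge0 ?exprn_ge0// lerXn2r.
Qed.

Lemma erlang_loss_le1 C rho : 0 <= rho -> erlang_loss C rho <= 1.
Proof.
move=> rho0; rewrite /erlang_loss -/(normalizer C rho).
rewrite ler_pdivrMr ?normalizer_gt0// mul1r /normalizer big_ord_recr/=.
by rewrite ler_wpDl// sumr_ge0// => i _; rewrite divr_ge0// exprn_ge0.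
Qed.

End ErlangLoss.

(** * Stationary distribution of the birth-death chain *)

Section Queue.
Context {R : realType}.
Variables (C : nat) (Lambda mu c : R) (p : R -> R).
Hypotheses (C_gt0 : (0 < C)%N) (mu_gt0 : 0 < mu).
Implicit Types (pi : nat -> R) (lambda : R).

Local Notation service i := (mu * (minn i.+1 C)%:R).

Lemma service_gt0 i : 0 < service i.
Proof. by rewrite mulr_gt0// ltr0n leq_min C_gt0. Qed.

Lemma weight_ge0 pi n : (forall i, 0 <= pi i) -> 0 <= weight C mu pi n.
Proof.
by move=> pi0; apply: prodr_ge0 => k _; rewrite divr_ge0// ltW// service_gt0.
Qed.

Lemma flow_balance pi i :
  pi i * stationary_prob C mu pi i = service i * stationary_prob C mu pi i.+1.
Proof.
rewrite /stationary_prob /weight big_ord_recr/= !mulrA; congr (_ / _).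
by field; rewrite pnatr_eq0 -lt0n leq_min C_gt0 gt_eqF.
Qed.

Lemma normalizer_gt0 pi : (forall i, 0 <= pi i) -> stable C mu pi ->
  0 < 1 + limn (series (fun n => weight C mu pi n.+1)).
Proof.
move=> pi0 st; apply: ltr_pwDl => //.
by apply: cvg_series_ge0 st => i; exact: weight_ge0.
Qed.

Lemma stationary_prob_ge0 pi i : (forall i, 0 <= pi i) -> stable C mu pi ->
  0 <= stationary_prob C mu pi i.
Proof.
by move=> pi0 st; rewrite divr_ge0 ?weight_ge0// ltW// normalizer_gt0.
Qed.

Lemma cvg_series_stationary_prob pi :
  (forall i, 0 <= pi i) -> stable C mu pi ->
  series (stationary_prob C mu pi) @ \oo --> (1 : R).
Proof.
move=> pi0 st; have W0 := normalizer_gt0 pi0 st.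
set W := 1 + _ in W0.
(* State 0 has weight 1 and is kept outside the series in the normalizer, hence the shift by one. *)
rewrite -(cvg_shiftS (series _)).
have : (fun n => (1 + series (fun n => weight C mu pi n.+1) n) / W) @ \oo -->
    W / W by apply: cvgMr_tmp; apply: cvgD => //; exact: cvg_cst.
rewrite divff ?gt_eqF// => h; apply: cvg_trans h.
apply: near_eq_cvg; apply: nearW => n; rewrite /series/= big_nat_recl//= mulrDl mulr_suml.
by rewrite /stationary_prob {2}/weight big_ord0.
Qed.

(** * Upper bounds for an arbitrary stable policy *)

Section StablePolicy.
Variable pi : nat -> R.
Hypotheses (pi_policy : policy Lambda pi) (pi_stable : stable C mu pi).

Local Notation P := (stationary_prob C mu pi).

Let pi_ge0 i : 0 <= pi i. Proof. by case/andP: (pi_policy i). Qed.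

Let P_ge0 i : 0 <= P i. Proof. exact: stationary_prob_ge0. Qed.

Let P_sum : series P @ \oo --> (1 : R).
Proof. exact: cvg_series_stationary_prob. Qed.

(** The rates are bounded by [Lambda], so the series is dominated by a multiple of [P]. This makes
    the [limn] in [avg_rate] a genuine limit. *)
Lemma cvg_series_avg_rate :
  series (fun i => pi i * P i) @ \oo --> avg_rate C mu pi.
Proof.
apply: (@is_cvg_weighted_series _ _ _ Lambda) => // [i|].
  by rewrite ger0_norm//; case/andP: (pi_policy i).
by apply/cvg_ex; exists 1.
Qed.

Lemma avg_rate_ge0 : 0 <= avg_rate C mu pi.
Proof. by apply: cvg_series_ge0 cvg_series_avg_rate => i; rewrite mulr_ge0. Qed.

(** By flow balance the average arrival rate is the average departure rate, and at most [C] servers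
    work at a time. *)
Lemma avg_rate_le_capacity : avg_rate C mu pi <= mu * C%:R.
Proof.
apply: (cvgr_to_le cvg_series_avg_rate); apply: nearW => n.
apply: (@le_trans _ _ (mu * C%:R * series P n.+1)).
  rewrite /series/= big_nat_recl//= mulrDr mulr_sumr.
  apply: ler_wpDl; first by rewrite mulr_ge0// mulr_ge0// ltW.
  apply: ler_sum => i _.
  by rewrite flow_balance ler_wpM2r// ler_pM2l// ler_nat geq_minr.
rewrite -[leRHS]mulr1 ler_wpM2l ?mulr_ge0 ?(ltW mu_gt0)//.
rewrite -(cvg_lim (@Rhausdorff R) P_sum); apply: nondecreasing_cvgn_le.
  exact: nondecreasing_series.
by apply/cvg_ex; exists 1.
Qed.

(** In state [i + 1] the departure rate is at most [mu * (i + 1)], so flow balance bounds each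
    partial sum of the arrival rate by [mu] times the mean size. *)
Lemma avg_rate_le_mean_size :
  ((avg_rate C mu pi / mu)%:E <= \sum_(0 <= i <oo) (i%:R * P i)%:E)%E.
Proof.
have iP0 i : (0%:E <= (i%:R * P i)%:E)%E by rewrite lee_fin mulr_ge0.
have part n : ((series (fun i => pi i * P i) n / mu)%:E <=
    \sum_(0 <= i <oo) (i%:R * P i)%:E)%E.
  apply: (@le_trans _ _ (\sum_(0 <= i < n.+1) (i%:R * P i)%:E)%E); last first.
    by apply: nneseries_lim_ge.
  rewrite sumEFin lee_fin big_nat_recl//= mul0r add0r /series/= mulr_suml.
  apply: ler_sum => i _; rewrite flow_balance mulrAC (mulrC mu) mulfK ?gt_eqF//.
  by apply: ler_wpM2r => //; rewrite ler_nat geq_minl.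
have : (0%:E <= \sum_(0 <= i <oo) (i%:R * P i)%:E)%E by exact: nneseries_ge0.
(* A stable policy may still have infinite mean size, where the bound is trivial; only a finite mean
   needs the passage to the limit. *)
case: (\sum_(0 <= i <oo) _)%E part => [L||]//= part _; last exact: leey.
have h : (fun n => series (fun i => pi i * P i) n / mu) @ \oo -->
    avg_rate C mu pi / mu by apply: cvgMr_tmp; exact: cvg_series_avg_rate.
rewrite lee_fin; apply: (cvgr_to_le h).
by apply: nearW => n; rewrite -lee_fin.
Qed.

(** Jensen's inequality for the convex function [- (x * p x)]; convergence is needed to take the
    sign out of [limn]. *)
Lemma revenue_le : concave_revenue Lambda p ->
  revenue C mu p pi <= avg_rate C mu pi * p (avg_rate C mu pi).
Proof.
move=> rc; have := jensen_series rc pi_policy P_ge0 P_sum.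
have cr : cvgn (series (fun i => - (pi i * p (pi i)) * P i)).
  by apply: (is_cvg_convex_series rc) => //; apply/cvg_ex; exists 1.
rewrite -/(avg_rate C mu pi) lerNl -lim_seriesN//.
rewrite (_ : - (fun _ => _) = fun i => pi i * p (pi i) * P i)//.
by apply/funext => i; rewrite opprfctE mulNr opprK.
Qed.

Lemma objective_le : 0 < c -> concave_revenue Lambda p ->
  (objective C mu c p pi <= (avg_rate C mu pi * p (avg_rate C mu pi) -
                             c * (avg_rate C mu pi / mu))%:E)%E.
Proof.
move=> c_gt0 rc; rewrite /objective /congestion_cost asboolT// EFinB.
apply: leeB; first by rewrite lee_fin revenue_le.
by rewrite EFinM lee_pmul2l// ?avg_rate_le_mean_size// lte_fin.
Qed.

End StablePolicy.

(** * The static policy as an Erlang loss system *)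

Lemma weight_static lambda n : (n <= C)%N ->
  weight C mu (static_policy lambda C.-1) n = (lambda / mu) ^+ n / n`!%:R.
Proof.
elim: n => [|n ih] nC; first by rewrite /weight big_ord0 expr0 fact0 divr1.
rewrite /weight big_ord_recr/= -/(weight _ _ _ n) ih 1?ltnW//.
rewrite /static_policy -ltnS prednK// nC (minn_idPl nC) exprS factS natrM.
by field; rewrite nat1r !pnatr_eq0 -lt0n fact_gt0 (gt_eqF mu_gt0).
Qed.

Lemma weight_static_gt lambda n : (C < n)%N ->
  weight C mu (static_policy lambda C.-1) n = 0.
Proof.
(* The product contains the factor of index [C], the first state with posted rate 0. *)
move=> Cn; rewrite /weight (bigD1 (Ordinal Cn))//=.
by rewrite /static_policy -ltnS prednK// ltnn !mul0r.
Qed.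

Section StaticPolicy.
Variable lambda : R.
Hypothesis lambda_ge0 : 0 <= lambda.

Local Notation pi := (static_policy lambda C.-1).
Local Notation P := (stationary_prob C mu pi).
Local Notation loss := (erlang_loss C (lambda / mu)).

Let pi_ge0 i : 0 <= pi i. Proof. by rewrite /static_policy; case: ifP. Qed.

Let pi_lt i : (i < C)%N -> pi i = lambda.
Proof. by move=> iC; rewrite /static_policy -ltnS prednK// iC. Qed.

Let pi_ge i : (C <= i)%N -> pi i = 0.
Proof. by move=> Ci; rewrite /static_policy -ltnS prednK// ltnNge Ci. Qed.

Let cvg_weight :
  series (fun n => weight C mu pi n.+1) @ \oo -->
  \sum_(0 <= n < C) weight C mu pi n.+1.
Proof. by apply: cvg_series_finite => n Cn; rewrite weight_static_gt. Qed.

Lemma static_stable : stable C mu pi.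
Proof. by apply/cvg_ex; eexists; exact: cvg_weight. Qed.

Lemma static_stationary_probC : P C = loss.
Proof.
rewrite /stationary_prob weight_static//; congr (_ / _).
rewrite (cvg_lim (@Rhausdorff R) cvg_weight).
rewrite -(big_mkord xpredT (fun n => (lambda / mu) ^+ n / n`!%:R)).
rewrite big_nat_recl//=.
rewrite expr0 fact0 divr1; congr (_ + _).
by apply: eq_big_nat => n /andP[_ nC]; rewrite weight_static.
Qed.

Lemma static_stationary_prob_gt i : (C < i)%N -> P i = 0.
Proof. by move=> Ci; rewrite /stationary_prob weight_static_gt// mul0r. Qed.

(** The states [0, ..., C] carry all the mass, and state [C], the only blocking one among them,
    carries [loss]. *)
Lemma static_admission_prob : \sum_(0 <= i < C) P i = 1 - loss.
Proof.
rewrite -static_stationary_probC; apply/eqP; rewrite eq_sym subr_eq eq_sym.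
rewrite -big_nat_recr//=; apply/eqP.
have h : series P @ \oo --> \sum_(0 <= i < C.+1) P i.
  by apply: cvg_series_finite => i Ci; exact: static_stationary_prob_gt.
rewrite -(cvg_lim (@Rhausdorff R) h).
apply: (cvg_lim (@Rhausdorff R)).
exact: cvg_series_stationary_prob static_stable.
Qed.

Lemma static_revenue : revenue C mu p pi = lambda * p lambda * (1 - loss).
Proof.
rewrite /revenue -static_admission_prob mulr_sumr.
rewrite (cvg_lim (@Rhausdorff R) (cvg_series_finite (N := C) _)).
  by apply: eq_big_nat => i /andP[_ iC]; rewrite pi_lt.
by move=> i Ci; rewrite pi_ge// !mul0r.
Qed.

(** Nobody waits, so below [C] flow balance reads [lambda * P i = mu * (i + 1) * P (i + 1)]; summing
    over [i < C] gives the mean. *)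
Lemma static_mean_size :
  (\sum_(0 <= i <oo) (i%:R * P i)%:E = (lambda / mu * (1 - loss))%:E)%E.
Proof.
rewrite (nneseries_finite (N := C.+1)); last first.
  by move=> i Ci; rewrite static_stationary_prob_gt// mulr0.
rewrite big_nat_recl//= mul0r add0r -static_admission_prob mulr_sumr.
congr EFin; apply: eq_big_nat => i /andP[_ iC].
have fb := flow_balance pi i; rewrite pi_lt// (minn_idPl iC) in fb.
rewrite [RHS]mulrAC fb.
by field; rewrite gt_eqF.
Qed.

Lemma static_objective :
  objective C mu c p pi =
  ((lambda * p lambda - c * (lambda / mu)) * (1 - loss))%:E.
Proof.
rewrite /objective /congestion_cost asboolT; last exact: static_stable.
by rewrite static_mean_size static_revenue -EFinM -EFinB mulrBl !mulrA.
Qed.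

End StaticPolicy.
End Queue.

Unset Implicit Arguments.

(** * Comparison of the optimal policy with the static one *)

Theorem theorem3 (R : realType) (C : nat) (Lambda mu c : R)
    (F : cumulativeBounded (0 : R) (1 : R)) (prices : set R) (p : R -> R)
    (pi : nat -> R)
    (C_ge1 : (1 <= C)%N) (Lambda_gt0 : 0 < Lambda) (mu_gt0 : 0 < mu)
    (c_gt0 : 0 < c)
    (F_regular : regular F)
    (p_inverse : inverse_demand Lambda F prices p)
    (revenue_concave : concave_revenue Lambda p)
    (pi_optimal : optimal_policy C Lambda mu c p pi) :
  (objective C mu c p pi *
     (1 - (C%:R ^+ C / C`!%:R) / \sum_(n < C.+1) C%:R ^+ n / n`!%:R)%:E
   <= objective C mu c p (static_policy (avg_rate C mu pi) C.-1))%E.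
Proof.
have [pi_policy pi_max] := pi_optimal.
have obj_ge0 : (0 <= objective C mu c p pi)%E.
  (* The zero policy is the static policy of rate 0, so [static_objective] evaluates it; [0 * p 0]
     vanishes whatever [p 0] is. *)
  have := pi_max (static_policy 0 C.-1).
  rewrite static_objective// !mul0r mulr0 subr0 mul0r; apply => i.
  by rewrite /static_policy if_same lexx ltW.
(* An unstable policy has congestion cost [+oo] against a real-valued [revenue], so its objective
   would be [-oo]. *)
have pi_stable : stable C mu pi.
  apply: contrapT => unstable; move: obj_ge0.
  by rewrite /objective /congestion_cost asboolF.
have obj_le :=
  objective_le C_ge1 mu_gt0 pi_policy pi_stable c_gt0 revenue_concave.
have a_ge0 := avg_rate_ge0 C_ge1 mu_gt0 pi_policy pi_stable.
have a_le := avg_rate_le_capacity C_ge1 mu_gt0 pi_policy pi_stable.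
rewrite static_objective// -/(erlang_loss C C%:R).
set a := avg_rate C mu pi in obj_le a_ge0 a_le *.
have net_ge0 : 0 <= a * p a - c * (a / mu).
  by rewrite -lee_fin (le_trans obj_ge0).
have loss_le : erlang_loss C (a / mu) <= erlang_loss C C%:R.
  apply: erlang_loss_le; first by rewrite divr_ge0// ltW.
  by rewrite ler_pdivrMr// mulrC.
(* The first inequality scales [obj_le] by a factor that is nonnegative as a loss probability is at
   most 1; the second lowers the load from [C] to [a / mu], using [net_ge0]. *)
apply: (@le_trans _ _ ((a * p a - c * (a / mu)) * (1 - erlang_loss C C%:R))%:E).
  by rewrite EFinM lee_wpmul2r// lee_fin subr_ge0 erlang_loss_le1.
by rewrite lee_fin ler_wpM2l// lerD2l lerN2.
Qed.
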